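(* Choose the branch of the complex logarithm that is analytic on $\mathbb{C}$ cut along the negative imaginary axis and takes the value $0$ at $1$. Let $\mu > -1$ be a real number and suppose $(a_1, \ldots,a_n) \in \mathbb{R}^n \setminus \{(0,\ldots,0)\}$. (a) If $|\mu-2p| < \tfrac{1}{2}$ for some nonnegative integer $p$, then $\mathrm{Re}\,h_{\mu}(a_1, \ldots, a_n) >0$. (b) If $|\mu-(2p-1)|<\tfrac{1}{2}$ for some integer $p \ge 0$, then $\mathrm{Re}\,h_\mu(a_1, \ldots,a_n)>0$ for $(a_1, \ldots,a_n) \in [0,\infty)^n$ and $\mathrm{Re}\,h_\mu(a_1, \ldots,a_n)<0$ for $(a_1, \ldots,a_n) \in (-\infty,0]^n$. (c) If $|\mu-p|=\tfrac{1}{2}$ for some nonnegative integer $p$, then $\mathrm{Re}\,h_\mu(a_1, \ldots,a_n)\ge 0$, and $\mathrm{Re}\,h_\mu(a_1, \ldots,a_n)=0$ for $(a_1, \ldots,a_n) \in (-\infty,0]^n$.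
   Context: Here $n\ge 1$ is an integer. With the stated branch of the logarithm put $x^w=e^{w\log x}$ for $x\in\mathbb{R}\setminus\{0\}$, $w\in\mathbb{C}$ (so $\log x=\log|x|+i\pi$ for $x<0$), and put $0^{w}:=0$ if $\mathrm{Re}\,w>0$. For $\mathrm{Re}\,z>-1$ the fractional degree complete homogeneous symmetric polynomial $h_z(a_1,\ldots,a_n)$ is defined as follows. If $a_1,\ldots,a_n$ are pairwise distinct real numbers (not $(0)$ when $n=1$), then $$h_z(a_1,\ldots,a_n)\prod_{1\le i<j\le n}(a_j-a_i) = \det\begin{bmatrix} 1 & a_1 & a_1^2 & \cdots & a_1^{n-2} & a_1^{z+n-1} \\ \vdots & \vdots & \vdots & \ddots & \vdots & \vdots \\ 1 & a_n & a_n^2 & \cdots & a_n^{n-2} & a_n^{z+n-1} \end{bmatrix}$$ (for $n=1$ this reads $h_z(a)=a^z$). For an arbitrary tuple $(a_1,\ldots,a_n)\in\mathbb{R}^n\setminus\{(0,\ldots,0)\}$, $h_z(a_1,\ldots,a_n)$ is defined by passage to the limit, i.e. as the limit of $h_z(b_1,\ldots,b_n)$ as $(b_1,\ldots,b_n)\to(a_1,\ldots,a_n)$ through real tuples with pairwise distinct entries; in particular, for real $a\ne 0$, $$h_z(a,\ldots,a)=\binom{z+n-1}{n-1}a^z=\frac{(z+n-1)\cdots(z+1)}{(n-1)!}\,a^z .$$ *)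

(* Defs.v *)
(* MathComp + MathComp-Analysis; the complex numbers are [R[i]], R : realType. *)
From HB Require Import structures.
From mathcomp Require Import all_boot all_order all_algebra.
From mathcomp Require Import all_classical all_reals all_analysis.
From mathcomp Require Import complex.
Set Implicit Arguments.
Unset Strict Implicit.
Unset Printing Implicit Defensive.
Import Order.TTheory GRing.Theory Num.Theory.
Import numFieldNormedType.Exports.
Local Open Scope classical_set_scope.
Local Open Scope ring_scope.
Local Open Scope complex_scope.

Section FractionalDegreeHomogeneous.
Variable R : realType.

Definition cexp (z : R[i]) : R[i] :=
  (expR (complex.Re z))%:C * (cos (complex.Im z) +i* sin (complex.Im z)).

(* The argument taking its values in ]-pi/2, 3pi/2[ on the plane cut along the
   negative imaginary axis; the value on the cut (0 included) is irrelevant. *)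
Definition carg (z : R[i]) : R :=
  let: x +i* y := z in
  if 0 < x then atan (y / x)
  else if x < 0 then pi + atan (y / x)
  else pi / 2.

(* The branch of the logarithm analytic off the negative imaginary axis with
   value 0 at 1; for real x < 0 it is ln |x| + i pi. *)
Definition clog (z : R[i]) : R[i] := ln (complex.Re `|z|) +i* carg z.

(* x^w for real x. 0^w is 0 when Re w > 0; for the other exponents the value at
   x = 0 is a dummy one. *)
Definition cpow (x : R) (w : R[i]) : R[i] :=
  if x == 0 then 0 else cexp (w * clog x%:C).

(* Row i is 1, a_i, ..., a_i^(n-2), a_i^(z+n-1); columns are numbered from 0. *)
Definition hmx n (z : R[i]) (a : 'rV[R]_n) : 'M[R[i]]_n :=
  \matrix_(i < n, j < n)
    if (j.+1 < n)%N then (a 0 i)%:C ^+ j else cpow (a 0 i) (z + n%:R - 1).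

Definition hdistinct n (z : R[i]) (a : 'rV[R]_n) : R[i] :=
  \det (hmx z a) /
  \prod_(i < n) \prod_(j < n | (i < j)%N) (a 0 j - a 0 i)%:C.

(* The fractional degree complete homogeneous symmetric polynomial h_z, meant
   for Re z > -1 and a != 0. The limit is taken through tuples with pairwise
   distinct entries; R[i]^o carries the topology of the modulus. *)
Definition hfrac n (z : R[i]) (a : 'rV[R]_n) : R[i] :=
  if injectiveb (a 0) then hdistinct z a
  else lim ((hdistinct z b : R[i]^o)
              @[b --> within [set b : 'rV[R]_n | injectiveb (b 0)] (nbhs a)]).

End FractionalDegreeHomogeneous.

(* Main.v *)
Require Import Defs.
From mathcomp Require Import all_boot all_order all_algebra.
From mathcomp Require Import all_classical all_reals all_analysis.
From mathcomp Require Import complex.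
From mathcomp Require Import ring lra zify.
Import Order.TTheory GRing.Theory Num.Theory.
Import numFieldNormedType.Exports.
Local Open Scope ring_scope.
Local Open Scope complex_scope.
Set Implicit Arguments.
Unset Strict Implicit.
Unset Printing Implicit Defensive.

(** Put w = mu + n - 1. The quotient of determinants defining h_mu is the
    divided difference at a_1, ..., a_n of x^w, whose real part is x^w for x > 0
    and cos (pi w) |x|^w for x < 0. The (n-1)-st derivative of this real part is
    a positive multiple of the function equal to x^mu for x > 0 and to
    cos (pi mu) |x|^mu for x < 0, so by the mean value theorem for divided
    differences (iterated Rolle) the sign of cos (pi mu) decides. When mu <= 0
    that derivative is singular at 0; Rolle is therefore iterated only n-2 times,
    which expresses the divided difference as a slope of the (n-2)-nd derivative.

    Repeated entries need two more facts. The limit exists: divide by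
    b_i - b_j as long as two limit entries differ, and use the slope formula when
    they all coincide. Strict inequalities survive the limit: on |x| <= M the
    (n-1)-st derivative dominates L (x^2 - rho), and the divided difference of
    x^(n+1) is h_2 >= (sum of b_i^2) / 2, which bounds the divided difference
    away from 0 near a <> 0. *)

(** * Divided differences *)

Section DividedDifference.
Variables (K : fieldType) (I : finType).
Implicit Types (b f g : I -> K) (A : {set I}) (i j : I).

(** The symmetric (Lagrange) form; with nodes indexed by a set, dropping one is [A :\ i] and no
    ordering is carried along. *)
Definition divdiff b f A : K :=
  \sum_(i in A) f i / \prod_(j in A :\ i) (b i - b j).

Lemma eq_divdiff b f g A : {in A, f =1 g} -> divdiff b f A = divdiff b g A.
Proof. by move=> fg; apply: eq_bigr => i /fg->. Qed.

Lemma divdiff1 b f i : divdiff b f [set i] = f i.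
Proof.
rewrite /divdiff big_set1 big1 ?divr1 // => j.
by rewrite !finset.inE; case: eqP.
Qed.

Lemma divdiffD b f g A :
  divdiff b (fun i => f i + g i) A = divdiff b f A + divdiff b g A.
Proof. by rewrite /divdiff -big_split; apply: eq_bigr => i _ /=; rewrite mulrDl. Qed.

Lemma divdiffZ b c f A : divdiff b (fun i => c * f i) A = c * divdiff b f A.
Proof. by rewrite /divdiff mulr_sumr; apply: eq_bigr => i _; rewrite mulrA. Qed.

Variable b : I -> K.
Hypothesis b_inj : injective b.

Let prod_neq0 A i : \prod_(j in A :\ i) (b i - b j) != 0.
Proof.
apply/prodf_neq0 => j; rewrite !finset.inE => /andP[jNi _].
by rewrite subr_eq0 (inj_eq b_inj) eq_sym.
Qed.

(** The factor [b i - b j] kills the term of node [j] and cancels one denominator factor in every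
    other term. *)
Lemma divdiff_setD1 f A j : j \in A ->
  divdiff b f (A :\ j) = divdiff b (fun i => (b i - b j) * f i) A.
Proof.
move=> jA; rewrite /divdiff [RHS](big_setD1 j) //= subrr !mul0r add0r.
apply: eq_bigr => i; rewrite !finset.inE => /andP[iNj iA].
have jAi : j \in A :\ i by rewrite !finset.inE eq_sym iNj.
have bij : b i - b j != 0 by rewrite subr_eq0 (inj_eq b_inj).
rewrite [in RHS](big_setD1 j) //= invfM mulrACA divff // mul1r.
by rewrite !finset.setDDl finset.setUC.
Qed.

(** The classical recursion with the division cleared: [divdiff_setD1] puts both terms back on [A],
    and [(b k - b j) - (b k - b i) = b i - b j]. *)
Lemma divdiff_rec f A i j : i \in A -> j \in A ->
  (b i - b j) * divdiff b f A = divdiff b f (A :\ j) - divdiff b f (A :\ i).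
Proof.
move=> iA jA; rewrite !divdiff_setD1 // /divdiff mulr_sumr -sumrB.
by apply: eq_bigr => k _; ring.
Qed.

(** Leibniz rule for the factor x, from [b k = b j + (b k - b j)]. *)
Lemma divdiff_mulX f A j : j \in A ->
  divdiff b (fun i => b i * f i) A = b j * divdiff b f A + divdiff b f (A :\ j).
Proof.
move=> jA; rewrite divdiff_setD1 // -divdiffZ -divdiffD.
by apply: eq_divdiff => k _; ring.
Qed.

Lemma divdiff_const A c : (1 < #|A|)%N -> divdiff b (fun=> c) A = 0.
Proof.
have [m] := ubnP #|A|; elim: m A => // m IH A Am A1.
have [i iA] : exists i, i \in A by apply/card_gt0P/ltnW.
have := A1; rewrite (cardsD1 i) iA ltnS => /card_gt0P[j].
rewrite 2!finset.inE => /andP[jNi jA].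
have bij : b i - b j != 0 by rewrite subr_eq0 (inj_eq b_inj) eq_sym.
apply: (mulfI bij); rewrite mulr0 divdiff_rec //.
have cD k : k \in A -> #|A :\ k| = #|A|.-1 by move=> kA; rewrite (cardsD1 k A) kA.
have [A2|A2] := ltnP 2 #|A|; first by rewrite !IH ?cD ?subrr //; lia.
have D1 k : k \in A -> divdiff b (fun=> c) (A :\ k) = c.
  move=> kA; have /cards1P[l ->] : #|A :\ k| == 1 by rewrite cD //; apply/eqP; lia.
  by rewrite divdiff1.
by rewrite !D1 // subrr.
Qed.

Let cardD A i : i \in A -> #|A :\ i| = #|A|.-1.
Proof. by move=> iA; rewrite (cardsD1 i A) iA. Qed.

Lemma divdiff_exp_lt A m : (m < #|A|.-1)%N -> divdiff b (fun i => b i ^+ m) A = 0.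
Proof.
elim: m A => [|m IH] A mA.
  under eq_divdiff do rewrite expr0.
  by apply: divdiff_const; lia.
have [i iA] : exists i, i \in A by apply/card_gt0P; lia.
under eq_divdiff do rewrite exprS.
rewrite (divdiff_mulX _ iA) !IH ?cardD ?mulr0 ?addr0 //; lia.
Qed.

Lemma divdiff_exp_eq A m : #|A| = m.+1 -> divdiff b (fun i => b i ^+ m) A = 1.
Proof.
elim: m A => [|m IH] A mA.
  have /cards1P[i ->] : #|A| == 1%N by apply/eqP.
  by rewrite divdiff1.
have [i iA] : exists i, i \in A by apply/card_gt0P; lia.
under eq_divdiff do rewrite exprS.
rewrite (divdiff_mulX _ iA) divdiff_exp_lt ?IH ?cardD ?mA ?mulr0 ?add0r //.
Qed.

Lemma divdiff_exp_h1 A : A != finset.set0 ->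
  divdiff b (fun i => b i ^+ #|A|) A = \sum_(i in A) b i.
Proof.
move: {2}#|A|.-1 (erefl #|A|.-1) => m; elim: m A => [|m IH] A mA A0;
  rewrite -card_gt0 in A0; have [i iA] := card_gt0P A0.
  have /cards1P[k ->] : #|A| == 1%N by apply/eqP; lia.
  by rewrite divdiff1 cards1 expr1 big_set1.
have Am : #|A| = m.+2 by lia.
rewrite Am; under eq_divdiff do rewrite exprS.
rewrite (divdiff_mulX _ iA) divdiff_exp_eq // mulr1.
have cD : #|A :\ i| = m.+1 by rewrite cardD // Am.
by rewrite -cD IH ?cD -?card_gt0 ?cD // (big_setD1 i iA).
Qed.

(** The divided difference of x^(|A|-1+k) is the complete homogeneous polynomial h_k of the nodes;
    here k = 2, in the form 2 h_2 = p_1^2 + p_2 with power sums p_i. *)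
Lemma divdiff_exp_h2 A : A != finset.set0 ->
  2 * divdiff b (fun i => b i ^+ #|A|.+1) A =
  (\sum_(i in A) b i) ^+ 2 + \sum_(i in A) b i ^+ 2.
Proof.
move: {2}#|A|.-1 (erefl #|A|.-1) => m; elim: m A => [|m IH] A mA A0;
  have AN0 := A0; rewrite -card_gt0 in A0; have [i iA] := card_gt0P A0.
  have /cards1P[k ->] : #|A| == 1%N by apply/eqP; lia.
  by rewrite divdiff1 cards1 !big_set1 mulrDl mul1r.
have Am : #|A| = m.+2 by lia.
have cD : #|A :\ i| = m.+1 by rewrite cardD // Am.
under eq_divdiff do rewrite exprS.
rewrite (divdiff_mulX _ iA) divdiff_exp_h1 // mulrDr Am -cD.
rewrite IH ?cD // -?card_gt0 ?cD // !(big_setD1 i iA) /=; ring.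
Qed.

(** The interpolation polynomial. Its top coefficient is the divided difference, which ties the sum
    formula to the determinant and to Rolle's theorem. *)
Definition lagrange f A : {poly K} :=
  \sum_(i in A) (f i / \prod_(j in A :\ i) (b i - b j)) *:
     \prod_(j in A :\ i) ('X - (b j)%:P).

Lemma lagrangeE f A i : i \in A -> (lagrange f A).[b i] = f i.
Proof.
move=> iA; rewrite /lagrange horner_sum (big_setD1 i) //= [X in _ + X]big1.
  rewrite addr0 hornerZ horner_prod.
  under [X in _ * X]eq_bigr do rewrite hornerXsubC.
  by rewrite divfK.
move=> j; rewrite !finset.inE => /andP[jNi jA].
rewrite hornerZ horner_prod [X in _ * X](big_setD1 i) /= ?finset.inE 1?eq_sym ?jNi //.
by rewrite hornerXsubC subrr mul0r mulr0.
Qed.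

Let size_basis A i : i \in A ->
  size (\prod_(j in A :\ i) ('X - (b j)%:P)) = #|A|.
Proof.
move=> iA; rewrite -big_enum size_prod_XsubC -cardE cardD // prednK //.
by apply/card_gt0P; exists i.
Qed.

Lemma size_lagrange f A : (size (lagrange f A) <= #|A|)%N.
Proof.
apply: (leq_trans (size_sum _ _ _)); apply/bigmax_leqP => i iA.
by rewrite (leq_trans (size_scale_leq _ _)) // size_basis.
Qed.

Lemma coef_lagrange f A : (lagrange f A)`_(#|A|.-1) = divdiff b f A.
Proof.
rewrite /lagrange coef_sum; apply: eq_bigr => i iA; rewrite coefZ.
have /monicP : \prod_(j in A :\ i) ('X - (b j)%:P) \is monic.
  by apply: monic_prod => j _; apply: monicXsubC.
by rewrite lead_coefE size_basis // => ->; rewrite mulr1.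
Qed.

End DividedDifference.

(** The matrix is a Vandermonde matrix times the identity whose last column is replaced by the
    coefficients of the interpolation polynomial. That factor is triangular, so only the top
    coefficient enters. *)
Lemma det_vandermonde_last (K : fieldType) n (b f : 'I_n -> K) : injective b ->
  (0 < n)%N ->
  \det (\matrix_(i < n, j < n) if (j.+1 < n)%N then b i ^+ j else f i) =
  divdiff b f [set: _]%SET * \prod_(i < n) \prod_(j < n | (i < j)%N) (b j - b i).
Proof.
move=> b_inj n0; pose p := lagrange b f [set: _]%SET.
have pb i : p.[b i] = f i by rewrite lagrangeE.
have sp : (size p <= n)%N by rewrite -[n]card_ord -cardsT size_lagrange.
have pl : p`_n.-1 = divdiff b f [set: _]%SET by rewrite -coef_lagrange cardsT card_ord.
pose V := Vandermonde n (\row_i b i).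
pose U := \matrix_(k < n, j < n) if (j.+1 < n)%N then (k == j)%:R else p`_k : K.
have -> : (\matrix_(i, j) if (j.+1 < n)%N then b i ^+ j else f i) = V^T *m U.
  apply/matrixP => i j; rewrite !mxE.
  under eq_bigr do rewrite !mxE.
  case: ltnP => jn.
    rewrite (bigD1 j) //= eqxx mulr1 big1 ?addr0 // => k /negPf ->.
    by rewrite mulr0.
  rewrite -pb (horner_coef_wide _ sp).
  by apply: eq_bigr => k _; rewrite mulrC.
rewrite det_mulmx det_tr det_Vandermonde mulrC; congr (_ * _); last first.
  by do 2!apply: eq_bigr => ? _; rewrite !mxE.
rewrite -det_tr det_trig; last first.
  apply/is_trig_mxP => i j ij; rewrite !mxE ifT; last by have := ltn_ord j; lia.
  by case: eqP => // ji; rewrite ji ltnn in ij.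
have ln : (n.-1 < n)%N by lia.
rewrite (bigD1 (Ordinal ln)) //= big1 ?mulr1 ?mxE ?ifF ?pl //=; first lia.
move=> i iN; rewrite !mxE ifT ?eqxx //.
have := ltn_ord i; move/eqP: iN => iN.
suff : (i : nat) <> n.-1 by lia.
by move=> e; apply: iN; apply/val_inj.
Qed.

(** * The mean value theorem for divided differences *)

Local Open Scope classical_set_scope.
Local Open Scope ring_scope.
Local Open Scope complex_scope.

Section MeanValue.
Variable R : realType.
Implicit Types (f df : R -> R) (x y : R) (s : seq R).

(** Rolle between consecutive zeros; the bounds through [x] and [last] keep the new zeros in the old
    interval. *)
Lemma rolle_path f df x s : (forall x, is_derive x 1 f (df x)) ->
  f x = 0 -> all (fun y => f y == 0) s -> path <%R x s ->
  exists s', [/\ size s' = size s, path <%R x s', last x s' <= last x s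
    & all (fun y => df y == 0) s'].
Proof.
move=> fdf; elim: s x => [|y s IH] x fx0 /=; first by exists [::].
move=> /andP[/eqP fy0 s0] /andP[xy ys].
have [s' [szs' ys' ls' s'0]] := IH y fy0 s0 ys.
have fcont : {within `[x, y], continuous f}.
  by apply: derivable_within_continuous => z _; exact: (@ex_derive _ _ _ _ _ _ _ (fdf z)).
have [z zxy fz] : exists2 z, z \in `]x, y[ & df z = 0.
  have fder z : z \in `]x, y[ -> derivable f z 1.
    by move=> _; exact: (@ex_derive _ _ _ _ _ _ _ (fdf z)).
  have [z zxy fz0] := Rolle xy fder fcont (etrans fx0 (esym fy0)).
  exists z => //; rewrite -(@derive_val _ _ _ _ _ _ _ (fdf z)).
  exact: derive_val.
have /andP[xz zy] : x < z < y by move: zxy; rewrite in_itv.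
exists (z :: s') => /=; rewrite szs' xz fz eqxx s'0; split=> //.
  by case: s' ys' {szs' ls' s'0} => //= t s' /andP[/(lt_trans zy) -> ->].
by case: s' ls' {szs' s'0 ys'} => //= /(le_trans (ltW zy)).
Qed.

Lemma rolle_iter (D : nat -> R -> R) m x s lo hi :
  (forall k, (k < m)%N -> forall x, is_derive x 1 (D k) (D k.+1 x)) ->
  all (fun y => D 0%N y == 0) (x :: s) -> path <%R x s ->
  lo <= x -> last x s <= hi -> (m <= size s)%N ->
  exists x' s', [/\ size s' = (size s - m)%N, path <%R x' s',
    lo <= x', last x' s' <= hi & all (fun y => D m y == 0) (x' :: s')].
Proof.
elim: m => [|m IH] DD D0 xs lox shi ms.
  by exists x, s; rewrite subn0.
have [x' [s' [szs' x's' lox' s'hi /=/andP[/eqP x'0 s'0]]]] :=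
  IH (fun k km => DD k (leqW km)) D0 xs lox shi (ltnW ms).
have [s'' [szs'' x's'' ls'' s''0]] := rolle_path (DD m (ltnSn _)) x'0 s'0 x's'.
case: s'' szs'' x's'' ls'' s''0 => [|y s''] /=; first by lia.
move=> szs'' /andP[x'y ys''] ls'' /andP[y0 s''0].
exists y, s''; split=> //=.
- by lia.
- exact: le_trans lox' (ltW x'y).
- exact: le_trans ls'' s'hi.
- by rewrite y0.
Qed.

(** The interpolation error has m+2 zeros, so after m Rolle steps its m-th derivative has two. There
    [D m] agrees with an affine function whose slope is the left-hand side. Stopping one step early
    asks nothing of the derivative of [D m]. *)
Lemma divdiff_mvt (I : finType) (b : I -> R) (A : {set I}) m (D : nat -> R -> R) lo hi :
  injective b -> #|A| = m.+2 ->
  (forall k, (k < m)%N -> forall x, is_derive x 1 (D k) (D k.+1 x)) ->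
  (forall i, i \in A -> lo <= b i <= hi) ->
  exists x y, [/\ lo <= x, x < y, y <= hi &
    m.+1`!%:R * divdiff b (fun i => D 0%N (b i)) A = (D m y - D m x) / (y - x)].
Proof.
move=> b_inj Am DD bA; pose p := lagrange b (fun i => D 0%N (b i)) A.
pose E k x := D k x - p^`(k).[x].
have EE k : (k < m)%N -> forall x, is_derive x 1 (E k) (E k.+1 x).
  move=> km x; rewrite /E derivnS; apply: is_deriveB; exact: DD.
pose s := sort <=%R [seq b i | i in A].
have ms : size s = m.+2 by rewrite size_sort size_map -cardE.
have memsP x : x \in s -> exists2 i, i \in A & x = b i.
  rewrite mem_sort => xs; have [i iA ->] := mapP xs.
  by exists i; rewrite // -mem_enum.
have ss : sorted <%R s.
  rewrite lt_sorted_uniq_le sort_uniq (sort_sorted (@le_total _ _)) andbT.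
  by rewrite map_inj_uniq // enum_uniq.
have s0 : all (fun y => E 0%N y == 0) s.
  by apply/allP => x /memsP[i iA ->]; rewrite /E derivn0 lagrangeE // subrr.
have sb x : x \in s -> lo <= x <= hi by move=> /memsP[i /bA ? ->].
case: s ms ss s0 sb {memsP} => //= x s [ms] xs s0 sb.
have lox : lo <= x by case/andP: (sb x (mem_head _ _)).
have shi : last x s <= hi by case/andP: (sb _ (mem_last x s)).
have mss : (m <= size s)%N by rewrite ms.
have [y [[|z [|z' s']] [/=]]] := rolle_iter EE s0 xs lox shi mss;
  rewrite ms; [lia| |lia].
move=> _ /andP[yz _] loy zhi /and3P[/eqP Ey /eqP Ez _].
exists y, z; split => //.
(* The degree of [p] is at most m+1, so its m-th derivative is affine. *)
have sp : (size p^`(m) <= 2)%N.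
  apply/leq_sizeP => j j2; rewrite coef_derivn nth_default ?mul0rn //.
  by rewrite (leq_trans (size_lagrange _ _ _)) // Am; lia.
have pE t : p^`(m).[t] = p^`(m)`_0 + p^`(m)`_1 * t.
  by rewrite (horner_coef_wide _ sp) !big_ord_recr big_ord0 /= add0r expr0 mulr1 expr1.
have p1 : p^`(m)`_1 = m.+1`!%:R * divdiff b (fun i => D 0%N (b i)) A.
  have pm : p`_m.+1 = divdiff b (fun i => D 0%N (b i)) A.
    by rewrite -coef_lagrange Am.
  rewrite coef_derivn addn1 pm mulr_natl; congr (_ *+ _).
  by rewrite -ffactnn ffactnSr subSnn muln1.
rewrite -p1; apply: (canRL (mulfK _)); first by rewrite subr_eq0 gt_eqF.
move: Ey Ez => /subr0_eq -> /subr0_eq ->; rewrite !pE; ring.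
Qed.

End MeanValue.

(** * One-sided powers *)

Section SignedPower.
Variable R : realType.
Implicit Types al be v x y : R.

(** Separate coefficients on the two half-lines make the family closed under differentiation. The
    value at 0 is the convention 0^v = 0 for v > 0 and a dummy otherwise. *)
Definition spow al be v x : R :=
  if 0 < x then al * x `^ v else if x < 0 then be * (- x) `^ v else 0.

Lemma spow_gt0 al be v x : 0 < x -> spow al be v x = al * x `^ v.
Proof. by rewrite /spow => ->. Qed.

Lemma spow_lt0 al be v x : x < 0 -> spow al be v x = be * (- x) `^ v.
Proof. by rewrite /spow => x0; rewrite lt_gtF // x0. Qed.

Lemma spow0 al be v : spow al be v 0 = 0.
Proof. by rewrite /spow ltxx. Qed.

Lemma norm_spow_le al be v x : `|spow al be v x| <= (`|al| + `|be|) * `|x| `^ v.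
Proof.
rewrite /spow; case: (ltgtP x 0) => x0.
- rewrite normrM (ger0_norm (powR_ge0 _ _)) (ler0_norm (ltW x0)).
  by rewrite ler_wpM2r ?powR_ge0 // lerDr.
- rewrite normrM (ger0_norm (powR_ge0 _ _)) (ger0_norm (ltW x0)).
  by rewrite ler_wpM2r ?powR_ge0 // lerDl.
- by rewrite normr0 mulr_ge0 ?addr_ge0 ?powR_ge0.
Qed.

Lemma norm_powR_cvg0 v : 0 < v -> `|x| `^ v @[x --> (0 : R)] --> (0 : R).
Proof.
move=> v0; apply/cvgrPdist_lt => e e0.
have d0 : 0 < e `^ v^-1 by rewrite powR_gt0.
exists (e `^ v^-1) => //= x; rewrite /= sub0r normrN => xd.
rewrite sub0r normrN ger0_norm ?powR_ge0 //.
have -> : e = (e `^ v^-1) `^ v by rewrite -powRrM mulVf ?gt_eqF // powRr1 // ltW.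
by apply: gt0_ltr_powR => //; rewrite nnegrE // ltW.
Qed.

(** Off 0 this is the power rule, the chain rule flipping the sign on the left; at 0 the difference
    quotient is O(|h|^(v-1)). *)
Lemma is_derive_spow al be v x : (x != 0) || (1 < v) ->
  is_derive x 1 (spow al be v) (v * spow al (- be) (v - 1) x).
Proof.
case: (ltgtP x 0) => [x0 _|x0 _|-> /= v1].
- apply: (@near_eq_is_derive _ _ _ (fun y => be * (- y) `^ v)).
    near=> y; rewrite spow_lt0 //; near: y; exact: lt_nbhsl.
  have Nx0 : 0 < - x by rewrite oppr_gt0.
  rewrite spow_lt0 //.
  have H := is_deriveZ be (is_derive1_comp (is_derive1_powR v Nx0) (is_deriveNid x 1)).
  refine (trigger_derive H _).
  by rewrite /GRing.scale /=; ring.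
- apply: (@near_eq_is_derive _ _ _ (fun y => al * y `^ v)).
    near=> y; rewrite spow_gt0 //; near: y; exact: lt_nbhsr.
  rewrite spow_gt0 //.
  apply: trigger_derive; first exact: (is_deriveZ al (is_derive1_powR v x0)).
  by rewrite /GRing.scale /=; ring.
- rewrite spow0 mulr0.
  have H : h^-1 *: (spow al be v (h *: 1 + 0) - spow al be v 0) @[h --> 0^'] --> (0 : R).
    apply/cvgr0Pnorm_lt => e e0.
    have C0 : 0 < `|al| + `|be| + 1 by rewrite ltr_wpDl ?addr_ge0.
    have := norm_powR_cvg0 (_ : 0 < v - 1); rewrite subr_gt0 => /(_ v1).
    move=> /cvgr0Pnorm_lt /(_ (e / (`|al| + `|be| + 1))).
    rewrite divr_gt0 // => /(_ isT) K.
    apply: cvg_within; near=> h.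
    (* [cvg_within] replaced the punctured neighbourhood by the full one, so h = 0 occurs; [invr0]
       makes the quotient 0 there. *)
    have [->|h0] := eqVneq h 0.
      by rewrite invr0 scale0r normr0.
    rewrite spow0 subr0 addr0 /GRing.scale /= mulr1.
    rewrite normrM normfV mulrC ltr_pdivrMr ?normr_gt0 //.
    apply: (le_lt_trans (norm_spow_le _ _ _ _)).
    have -> : v = (v - 1) + 1 by rewrite subrK.
    rewrite powRD; last by rewrite normr_eq0 h0 implybT.
    rewrite powRr1 // mulrA ltr_pM2r ?normr_gt0 //.
    apply: (@le_lt_trans _ _ ((`|al| + `|be| + 1) * `|h| `^ (v - 1))).
      by rewrite ler_wpM2r ?powR_ge0 // lerDl.
    rewrite mulrC -ltr_pdivlMr //.
    have : `| `|h| `^ (v - 1) | < e / (`|al| + `|be| + 1) by near: h.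
    by rewrite ger0_norm ?powR_ge0.
  apply: DeriveDef; first by apply/cvg_ex; exists 0.
  exact: cvg_lim H.
Unshelve. all: by end_near. Qed.

Lemma spow_continuous al be v x : (x != 0) || (0 < v) ->
  spow al be v y @[y --> x] --> spow al be v x.
Proof.
have [-> /= v0|x0 _] := eqVneq x 0.
  rewrite spow0; apply/cvgr0Pnorm_le => e e0.
  have C0 : 0 < `|al| + `|be| + 1 by rewrite ltr_wpDl ?addr_ge0.
  have /cvgr0Pnorm_le/(_ (e / (`|al| + `|be| + 1))) := norm_powR_cvg0 v0.
  rewrite divr_gt0 // => /(_ isT); apply: filterS => y.
  rewrite ger0_norm ?powR_ge0 // ler_pdivlMr // => ye.
  apply: le_trans (norm_spow_le _ _ _ _) (le_trans _ ye).
  by rewrite mulrC ler_wpM2l ?powR_ge0 // lerDl.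
have H : is_derive x 1 (spow al be v) (v * spow al (- be) (v - 1) x).
  by apply: is_derive_spow; rewrite x0.
exact/differentiable_continuous/derivable1_diffP/(@ex_derive _ _ _ _ _ _ _ H).
Qed.

End SignedPower.

(** * Limits of divided differences of one-sided powers *)

Section SignedPowerDivDiff.
Variable R : realType.
Implicit Types al be w x y : R.

(** The k-th derivative of [spow al be w]; the sign (-1)^k comes from differentiating (-x)^w. *)
Definition spowD al be w k x : R :=
  (\prod_(j < k) (w - j%:R)) * spow al ((-1) ^+ k * be) (w - k%:R) x.

Lemma spowD0 al be w : spowD al be w 0 = spow al be w.
Proof. by apply/funext => x; rewrite /spowD big_ord0 !mul1r subr0. Qed.

Lemma is_derive_spowD al be w k x : (x != 0) || (1 < w - k%:R) ->
  is_derive x 1 (spowD al be w k) (spowD al be w k.+1 x).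
Proof.
move=> H; refine (trigger_derive (is_deriveZ _ (is_derive_spow al _ H)) _).
rewrite /GRing.scale /= /spowD big_ord_recr /= exprS mulN1r mulNr -natr1 opprD.
by rewrite [in RHS]addrA mulrA.
Qed.

Lemma spowD_continuous al be w k x : (x != 0) || (0 < w - k%:R) ->
  spowD al be w k y @[y --> x] --> spowD al be w k x.
Proof. by move=> H; apply: cvgM; [exact: cvg_cst|exact: spow_continuous]. Qed.

Variable n : nat.
Implicit Types (a b : 'rV[R]_n) (A : {set 'I_n}).

Definition divdiff_spow al be w A b : R :=
  divdiff (b 0) (fun i => spow al be w (b 0 i)) A.

Definition inj_nbhs a := within [set b : 'rV[R]_n | injectiveb (b 0)] (nbhs a).

Global Instance inj_nbhs_filter a : Filter (inj_nbhs a).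
Proof. exact: within_filter. Qed.

Lemma near_inj_nbhs a : \forall b \near inj_nbhs a, injective ((b : 'rV[R]_n) 0).
Proof. by rewrite /inj_nbhs near_withinE; apply: nearW => b /injectiveP. Qed.

Lemma cvg_coord_inj_nbhs a i : (fun b : 'rV[R]_n => b 0 i) @ inj_nbhs a --> a 0 i.
Proof.
exact: (@cvg_within_filter _ _ _ (nbhs a) _ _ _ (@coord_continuous R 1 n 0 i a)).
Qed.

(** By [divdiff_mvt] and the ordinary mean value theorem, (m+1)! times the divided difference is a
    value of the (m+1)-st derivative at a point squeezed towards [c]; the last hypothesis makes that
    derivative continuous at [c]. *)
Lemma divdiff_spow_cvg_diag a A al be w m c : #|A| = m.+2 -> m%:R < w ->
  (forall i, i \in A -> a 0 i = c) -> (c != 0) || (m.+1%:R < w) ->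
  divdiff_spow al be w A @ inj_nbhs a -->
  spowD al be w m.+1 c / m.+1`!%:R.
Proof.
move=> Am mw aA cw; apply/cvgrPdist_le => e e0.
have m1 : 0 < m.+1`!%:R :> R by rewrite ltr0n fact_gt0.
have cont : spowD al be w m.+1 x @[x --> c] --> spowD al be w m.+1 c.
  by apply: spowD_continuous; rewrite subr_gt0.
have : \forall x \near c, (x != 0) || (1 < w - m%:R).
  case/orP: cw => [c0|mw1].
    by near do (apply/orP; left); exact: open_neq.
  by near=> x; apply/orP; right; rewrite ltrBrDr addrC natr1.
have /cvgrPdist_le/(_ (m.+1`!%:R * e)) := cont; rewrite mulr_gt0 // => /(_ isT) N1.
move=> /(filterI N1) [d /= d0 Nd].
(* Nodes within d/2 of [c] lie in a closed interval contained in the open ball of radius [d]. *)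
have d2 : 0 < d / 2 by rewrite divr_gt0.
have nbA : \forall b \near inj_nbhs a,
    forall i, i \in A -> c - d / 2 <= (b : 'rV[R]_n) 0 i <= c + d / 2.
  apply: filter_forall => i; case: (boolP (i \in A)) => [iA|_]; last by near=> b.
  have /cvgrPdist_le/(_ _ d2) := @cvg_coord_inj_nbhs a i.
  by rewrite aA // => K; near=> b => _; rewrite -ler_distlC; near: b.
near=> b.
have b_inj : injective (b 0) by near: b; exact: near_inj_nbhs.
have bA i : i \in A -> c - d / 2 <= b 0 i <= c + d / 2.
  by move: i; near: b.
have DD k : (k < m)%N ->
    forall x, is_derive x 1 (spowD al be w k) (spowD al be w k.+1 x).
  move=> km x; apply: is_derive_spowD; apply/orP; right.
  rewrite ltrBrDr addrC natr1; apply: le_lt_trans mw; by rewrite ler_nat.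
have [x [y [lox xy yhi dE]]] := divdiff_mvt b_inj Am DD bA.
have near_c z : x <= z <= y -> ball_ Num.norm c d z.
  move=> /andP[xz zy]; rewrite /= ltr_distlC; apply/andP; split; lra.
have Dder z : x <= z <= y -> is_derive z 1 (spowD al be w m) (spowD al be w m.+1 z).
  by move=> /near_c/Nd[_ ?]; exact: is_derive_spowD.
have Dcont : {within `[x, y], continuous (spowD al be w m)}.
  apply: derivable_within_continuous => z; rewrite in_itv /= => /Dder H.
  exact: (@ex_derive _ _ _ _ _ _ _ H).
have Doo z : z \in `]x, y[ -> is_derive z 1 (spowD al be w m) (spowD al be w m.+1 z).
  by rewrite in_itv /= => /andP[xz zy]; apply: Dder; rewrite !ltW.
have [z zxy zE] := MVT xy Doo Dcont.
have /near_c/Nd[zD _] : x <= z <= y.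
  by move: zxy; rewrite in_itv /= => /andP[? ?]; rewrite !ltW.
move: dE; rewrite zE mulfK ?subr_eq0 ?gt_eqF // spowD0 => dE.
rewrite -[divdiff_spow _ _ _ _ _](mulKf (lt0r_neq0 m1)) dE mulrC -mulrBr.
by rewrite normrM gtr0_norm ?invr_gt0 // ler_pdivrMl.
Unshelve. all: by end_near. Qed.

(** Induction on the number of nodes: if two limit entries differ, use the recursion; otherwise the
    diagonal case applies. Dropping a node may leave only zero limits, but the bound on [w] then has
    one unit to spare, hence the disjunction. *)
Lemma divdiff_spow_cvg a A al be w : A != finset.set0 -> #|A|%:R - 2 < w ->
  (exists2 i, i \in A & a 0 i != 0) \/ #|A|%:R - 1 < w ->
  cvg (divdiff_spow al be w A @ inj_nbhs a).
Proof.
move: {2}#|A|.-1 (erefl #|A|.-1) w => m; elim: m A => [|m IH] A mA w;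
  rewrite -card_gt0 => A0 Aw aw; have [i0 iA0] := card_gt0P A0.
  have /cards1P[i Ai] : #|A| == 1%N by apply/eqP; lia.
  move: aw Aw; rewrite Ai cards1 => aw Aw.
  have H : spow al be w ((b : 'rV[R]_n) 0 i) @[b --> inj_nbhs a] --> spow al be w (a 0 i).
    apply: (cvg_comp _ _ (@cvg_coord_inj_nbhs a i)).
    apply: spow_continuous; case: aw => [[j /set1P ->] ->//|aw].
    by apply/orP; right; lra.
  apply: cvgP; apply: cvg_trans H; apply: (near_eq_cvg (FF := inj_nbhs_filter a)).
  by near=> b; rewrite /divdiff_spow divdiff1.
have Am : #|A| = m.+2 by lia.
move: Aw; rewrite Am -[m.+2]addn2 natrD addrK => Aw.
have [[i [j [iA jA aij]]]|aconst] :=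
    pselect (exists i j, [/\ i \in A, j \in A & a 0 i != a 0 j]).
  have sub k : k \in A -> 
      cvg (divdiff_spow al be w (A :\ k) @ inj_nbhs a).
    move=> kA; have cD : #|A :\ k| = m.+1 by have := cardsD1 k A; rewrite kA Am; lia.
    apply: IH; rewrite -?card_gt0 cD //.
      by rewrite -natr1; lra.
    by right; rewrite -natr1 addrK.
  have bij : a 0 i - a 0 j != 0 by rewrite subr_eq0.
  have Vij : ((b : 'rV[R]_n) 0 i - b 0 j)^-1 @[b --> inj_nbhs a] --> (a 0 i - a 0 j)^-1.
    by apply: cvgV => //; apply: cvgB; exact: cvg_coord_inj_nbhs.
  have /cvg_ex[/= l1 H1] := sub _ jA; have /cvg_ex[/= l2 H2] := sub _ iA.
  have H : (fun b : 'rV[R]_n => (b 0 i - b 0 j)^-1 *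
      (divdiff_spow al be w (A :\ j) b - divdiff_spow al be w (A :\ i) b)) @ inj_nbhs a
      --> (a 0 i - a 0 j)^-1 * (l1 - l2).
    by apply: cvgM => //; exact: cvgB.
  apply: cvgP; apply: cvg_trans H; apply: (near_eq_cvg (FF := inj_nbhs_filter a)).
  near=> b.
  have b_inj : injective (b 0) by near: b; exact: near_inj_nbhs.
  rewrite /= /divdiff_spow -divdiff_rec // mulKf //.
  by rewrite subr_eq0 (inj_eq b_inj); apply: contra_neq aij => ->.
have ac i : i \in A -> a 0 i = a 0 i0.
  by move=> iA; apply: contra_notP aconst => /eqP ne; exists i, i0.
apply/cvg_ex; eexists; apply: (divdiff_spow_cvg_diag Am Aw ac).
case: aw => [[i /ac -> ->]//|]; rewrite Am -natr1 addrK => ->; exact: orbT.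
Unshelve. all: by end_near. Qed.

End SignedPowerDivDiff.

(** * Comparison with polynomials and lower bounds *)

Section LowerBound.
Variables (R : realType) (n : nat).
Implicit Types (al be w x y : R) (b : 'rV[R]_n) (A : {set 'I_n}) (q : {poly R}).

(** For more than one node, the slope formula reduces this to monotonicity of the (m-1)-st
    derivative of the difference. The m-th one may fail to exist at 0, so monotonicity is proved on
    each side of 0 and joined there by continuity. *)
Lemma divdiff_spow_ge_poly al be w m A b q M :
  injective (b 0) -> #|A| = m.+1 -> -1 < w - m%:R ->
  (forall i, i \in A -> `|b 0 i| <= M) ->
  (forall x, `|x| <= M -> q^`(m).[x] <= spowD al be w m x) ->
  divdiff (b 0) (fun i => q.[b 0 i]) A <= divdiff_spow al be w A b.
Proof.
case: m => [|m] b_inj Am wm bM qle.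
  have /cards1P[i Ai] : #|A| == 1%N by apply/eqP.
  rewrite /divdiff_spow Ai !divdiff1 -[spow _ _ _](spowD0 al be w); apply: qle.
  by apply: bM; rewrite Ai finset.set11.
have mw : m%:R < w by move: wm; rewrite -natr1; lra.
pose D k x := spowD al be w k x - q^`(k).[x].
have Dder k x : (x != 0) || (1 < w - k%:R) -> is_derive x 1 (D k) (D k.+1 x).
  by move=> H; rewrite /D derivnS; apply: is_deriveB; exact: is_derive_spowD.
have DD k : (k < m)%N -> forall x, is_derive x 1 (D k) (D k.+1 x).
  move=> km x; apply: Dder; apply/orP; right.
  by rewrite ltrBrDr addrC natr1; apply: le_lt_trans mw; rewrite ler_nat.
have bA i : i \in A -> - M <= b 0 i <= M by move=> /bM; rewrite ler_norml.
have [x [y [Mx xy yM]]] := divdiff_mvt b_inj Am DD bA.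
have Dcont z : D m u @[u --> z] --> D m z.
  apply: cvgB; last exact: continuous_horner.
  by apply: spowD_continuous; rewrite subr_gt0 mw orbT.
(* The last condition keeps 0 out of the open interval from [u] to [v]. *)
have mono u v : u <= v -> -M <= u -> v <= M -> (0 <= u) || (v <= 0) -> D m u <= D m v.
  move=> uv Mu vM uv0.
  have sub z : z \in `]u, v[ -> is_derive z 1 (D m) (D m.+1 z).
    rewrite in_itv /= => /andP[uz zv]; apply: Dder.
    apply/orP; left; case/orP: uv0 => ?; [rewrite gt_eqF //|rewrite lt_eqF //]; lra.
  have cont : {within `[u, v], continuous (D m)}.
    by apply: continuous_subspaceT => z; exact: Dcont.
  have [z zuv zE] := MVT_segment uv sub cont.
  rewrite -subr_ge0 zE mulr_ge0 ?subr_ge0 //; apply: qle.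
  move: zuv; rewrite in_itv /= => /andP[? ?]; rewrite ler_norml; apply/andP; split; lra.
have Dxy : D m x <= D m y.
  case: (lerP 0 x) => x0; first by apply: mono; rewrite ?x0 //; lra.
  case: (lerP y 0) => y0; first by apply: mono; rewrite ?y0 ?orbT //; lra.
  by apply: (@le_trans _ _ (D m 0)); apply: mono; rewrite ?lexx ?orbT //; lra.
move=> dE.
have : 0 <= m.+1`!%:R * divdiff (b 0) (fun i => D 0%N (b 0 i)) A.
  by rewrite dE divr_ge0 // subr_ge0 // ltW.
rewrite pmulr_rge0 ?ltr0n ?fact_gt0 // /D.
under eq_divdiff do rewrite spowD0 derivn0 -mulN1r.
by rewrite divdiffD divdiffZ mulN1r subr_ge0.
Qed.

Lemma falling_gt0 w m : -1 < w - m%:R -> 0 < \prod_(j < m) (w - j%:R).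
Proof.
move=> wm; apply: prodr_gt0 => j _.
have : (j.+1%:R <= m%:R :> R) by rewrite ler_nat.
rewrite -natr1; lra.
Qed.

(** Comparison with the zero polynomial: the m-th derivative has the nonnegative coefficients 1 and
    [(-1) ^+ m * be], up to a positive falling factorial. *)
Lemma divdiff_spow_ge0 be w m A b :
  injective (b 0) -> #|A| = m.+1 -> -1 < w - m%:R -> 0 <= (-1) ^+ m * be ->
  0 <= divdiff_spow 1 be w A b.
Proof.
move=> b_inj Am wm be0.
have -> : 0 = divdiff (b 0) (fun i => (0 : {poly R}).[b 0 i]) A :> R.
  by rewrite /divdiff big1 // => i _; rewrite horner0 mul0r.
apply: (@divdiff_spow_ge_poly _ _ _ m _ _ _ (\sum_i `|b 0 i|)) => //.
  by move=> i _; rewrite (bigD1 i) //= lerDl sumr_ge0.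
move=> x _; rewrite linear0 horner0; apply: mulr_ge0; first exact/ltW/falling_gt0.
rewrite /spow; case: ifP => _; first by rewrite mul1r powR_ge0.
by case: ifP => _ //; rewrite mulr_ge0 ?powR_ge0.
Qed.

Lemma powR_ge_min r M v x : 0 < r -> r <= x -> x <= M ->
  Num.min (r `^ v) (M `^ v) <= x `^ v.
Proof.
move=> r0 rx xM; have x0 := lt_le_trans r0 rx; have M0 := lt_le_trans x0 xM.
rewrite ge_min; case: (lerP 0 v) => v0.
  by rewrite ge0_ler_powR ?nnegrE // ltW.
apply/orP; right; rewrite -[v]opprK 2!(powRN _ (- v)).
rewrite lef_pV2 ?posrE ?powR_gt0 // ge0_ler_powR ?nnegrE ?(ltW x0) ?(ltW M0) //; lra.
Qed.

(* Compares with the polynomial whose m-th derivative is L (x^2 - rho): below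
   |x| = sqrt rho it is negative, and its divided difference is explicit. *)
Lemma divdiff_spow_lower_bound be w m A M s : #|A| = m.+1 ->
  -1 < w - m%:R -> 0 < (-1) ^+ m * be -> 0 < M -> 0 < s ->
  exists2 d, 0 < d & forall b, injective (b 0) ->
    (forall i, i \in A -> `|b 0 i| <= M) -> s <= \sum_(i in A) b 0 i ^+ 2 ->
    d <= divdiff_spow 1 be w A b.
Proof.
move=> Am wm c0 M0 s0; set c := (-1) ^+ m * be in c0.
have f0 k : 0 < k`!%:R :> R by rewrite ltr0n fact_gt0.
have f0' k : k`!%:R != 0 :> R by rewrite gt_eqF.
pose K := \prod_(j < m) (w - j%:R); have K0 : 0 < K by exact: falling_gt0.
(* Chosen so that rho/m! is half of s/(m+2)!, the bound supplied by h_2. *)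
pose rho := s / 2 * (m`!%:R / m.+2`!%:R).
have rho0 : 0 < rho by rewrite mulr_gt0 // divr_gt0.
pose r := Num.sqrt rho; have r0 : 0 < r by rewrite sqrtr_gt0.
pose kappa := Num.min (r `^ (w - m%:R)) (M `^ (w - m%:R)).
have kappa0 : 0 < kappa by rewrite lt_min !powR_gt0.
pose c1 := Num.min 1 c; have c10 : 0 < c1 by rewrite lt_min ltr01.
(* Chosen so that L M^2 = K c1 kappa, a lower bound for the m-th derivative on sqrt rho < |x| <=
   M. *)
pose L := K * (c1 * kappa) / M ^+ 2.
have L0 : 0 < L by rewrite divr_gt0 ?exprn_gt0 // !mulr_gt0.
pose q : {poly R} := L *: ((2 / m.+2`!%:R) *: 'X^(m.+2) - (rho / m`!%:R) *: 'X^m).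
exists (L * (s / 2 / m.+2`!%:R)); first by rewrite mulr_gt0 // !divr_gt0.
move=> b b_inj bM bs.
apply: le_trans (_ : divdiff (b 0) (fun i => q.[b 0 i]) A <= _).
  have A0 : A != finset.set0 by rewrite -card_gt0 Am.
  have h2 := divdiff_exp_h2 b_inj A0; rewrite Am in h2.
  have h0 := divdiff_exp_eq b_inj Am.
  have -> : divdiff (b 0) (fun i => q.[b 0 i]) A =
      L * ((2 * divdiff (b 0) (fun i => b 0 i ^+ m.+2) A) / m.+2`!%:R - rho / m`!%:R).
    transitivity (divdiff (b 0) (fun i => L * ((2 / m.+2`!%:R) * b 0 i ^+ m.+2 +
       (- (rho / m`!%:R)) * b 0 i ^+ m)) A).
      by apply: eq_divdiff => i _; rewrite /q !(hornerE, hornerXn) mulNr.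
    by rewrite divdiffZ divdiffD !divdiffZ h0 mulr1; congr (L * (_ - _)); rewrite mulrAC.
  rewrite ler_pM2l // h2 lerBrDr.
  have -> : s / 2 / m.+2`!%:R + rho / m`!%:R = s / m.+2`!%:R.
    by rewrite /rho; field; rewrite !f0'.
  rewrite ler_pM2r ?invr_gt0 //; apply: le_trans bs _.
  by rewrite lerDr sqr_ge0.
apply: divdiff_spow_ge_poly b_inj Am wm bM _ => x xM.
have -> : q^`(m).[x] = L * (x ^+ 2 - rho).
  have m2 : (m.+2 - m = 2)%N by rewrite !subSn // subnn.
  have := @ffact_fact m.+2 m; rewrite leqW // m2 => /(_ isT).
  move=> /(congr1 (fun k => k%:R : R)); rewrite natrM => E.
  rewrite /q !(derivnZ, derivnB) !derivnXn subnn ffactnn m2.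
  rewrite !(hornerZ, hornerD, hornerN, hornerMn, hornerXn) expr0.
  congr (L * (_ - _)); last by rewrite divfK.
  rewrite -(mulr_natr (x ^+ 2)) mulrA mulrAC -[RHS]mul1r; congr (_ * _).
  by rewrite mulrAC [2 * _]mulrC E divff.
rewrite /spowD -/K -/c.
have sp0 : 0 <= spow 1 c (w - m%:R) x.
  rewrite /spow; case: ifP => _; first by rewrite mul1r powR_ge0.
  by case: ifP => _ //; rewrite mulr_ge0 ?powR_ge0 // ltW.
have [xr|rx] := lerP (x ^+ 2) rho.
  apply: le_trans (_ : 0 <= _); last by rewrite mulr_ge0 // ltW.
  by rewrite pmulr_rle0 // subr_le0.
have {}rx : r < `|x|.
  by rewrite -sqrtr_sqr ltr_sqrt // (lt_trans rho0).
have spE : c1 * kappa <= spow 1 c (w - m%:R) x.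
  apply: le_trans (_ : c1 * `|x| `^ (w - m%:R) <= _).
    by rewrite ler_pM2l // powR_ge_min // ltW.
  rewrite /spow; case: (ltgtP x 0) rx => x0 rx.
  - by rewrite ltr0_norm // ler_wpM2r ?powR_ge0 // ge_min lexx orbT.
  - by rewrite gtr0_norm // ler_wpM2r ?powR_ge0 // ge_min lexx.
  - by move: rx; rewrite x0 normr0 ltNge ltW.
apply: le_trans (_ : K * (c1 * kappa) <= _); last by rewrite ler_pM2l.
have -> : K * (c1 * kappa) = L * M ^+ 2 by rewrite divfK // gt_eqF // exprn_gt0.
rewrite ler_pM2l //.
have : x ^+ 2 <= M ^+ 2.
  by rewrite -[x ^+ 2]real_normK ?num_real // ler_pXn2r ?nnegrE // ltW.
lra.
Qed.

End LowerBound.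

(** * From the determinant to the divided difference *)

Section Hfrac.
Variable R : realType.
Implicit Types (mu w x : R).

Lemma rV_neq0_ex n (a : 'rV[R]_n) : a != 0 -> exists i, a 0 i != 0.
Proof.
move=> a0; apply/existsP; apply: contraR a0 => /existsPn a0.
by apply/eqP/rowP => i; rewrite mxE; apply/eqP; rewrite -[_ == _]negbK a0.
Qed.

(** For x < 0 the branch gives log x = ln |x| + i pi, hence x^w = |x|^w (cos (pi w) + i sin (pi
    w)). *)
Lemma cpow_realE x w :
  cpow x w%:C = spow 1 (cos (w * pi)) w x +i* spow 0 (sin (w * pi)) w x.
Proof.
rewrite /cpow /spow; case: (ltgtP x 0) => [x0|x0|_] //.
- have nx : `|x%:C| = (- x)%:C.
    by rewrite normc_def /= expr0n /= addr0 sqrtr_sqr ltr0_norm.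
  have cx : carg x%:C = pi by rewrite /carg /= (lt_gtF x0) x0 mul0r atan0 addr0.
  rewrite /clog nx cx /cexp /= !mul0r subr0 addr0 /powR oppr_eq0 lt_eqF //=.
  by congr (_ +i* _); ring.
- have nx : `|x%:C| = x%:C.
    by rewrite normc_def /= expr0n /= addr0 sqrtr_sqr gtr0_norm.
  have cx : carg x%:C = 0 by rewrite /carg /= x0 mul0r atan0.
  rewrite /clog nx cx /cexp /= !mulr0 !mul0r subr0 addr0 cos0 sin0 /powR gt_eqF //=.
  by congr (_ +i* _); ring.
Qed.

Lemma divdiff_complex (I : finType) (b f g : I -> R) (A : {set I}) :
  divdiff (fun i => (b i)%:C) (fun i => f i +i* g i) A =
  divdiff b f A +i* divdiff b g A.
Proof.
rewrite [RHS]complexE /= /divdiff !rmorph_sum mulr_sumr -big_split /=.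
apply: eq_bigr => i _.
have -> : \prod_(j in A :\ i) ((b i)%:C - (b j)%:C) =
    (\prod_(j in A :\ i) (b i - b j))%:C.
  by rewrite rmorph_prod; apply: eq_bigr => j _; rewrite rmorphB.
by rewrite !fmorph_div /= mulrA -mulrDl; congr (_ / _); rewrite [LHS]complexE.
Qed.

Lemma hdistinctE n mu (b : 'rV[R]_n) : (0 < n)%N -> injective (b 0) ->
  let w := mu + n%:R - 1 in
  hdistinct mu%:C b = divdiff_spow 1 (cos (w * pi)) w [set: 'I_n]%SET b +i*
                      divdiff_spow 0 (sin (w * pi)) w [set: 'I_n]%SET b.
Proof.
move=> n0 b_inj w; rewrite /hdistinct /hmx /divdiff_spow -divdiff_complex.
have bC_inj : injective (fun i => (b 0 i)%:C) by move=> i j /complexI/b_inj.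
have -> : mu%:C + n%:R - 1 = w%:C :> R[i].
  by rewrite /w rmorphB rmorphD rmorph_nat rmorph1.
rewrite (det_vandermonde_last _ bC_inj n0).
have -> : \prod_(i < n) \prod_(j < n | (i < j)%N) (b 0 j - b 0 i)%:C =
    \prod_(i < n) \prod_(j < n | (i < j)%N) ((b 0 j)%:C - (b 0 i)%:C) :> R[i].
  by do 2!apply: eq_bigr => ? _; rewrite rmorphB.
rewrite mulfK; last first.
  apply/prodf_neq0 => i _; apply/prodf_neq0 => j ij.
  by rewrite subr_eq0 (inj_eq bC_inj) gt_eqF.
by apply: eq_divdiff => i _; rewrite cpow_realE.
Qed.

Lemma cvg_complex (T : Type) (F : set_system T) (f g : T -> R) (u v : R) :
  Filter F -> f @ F --> u -> g @ F --> v ->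
  ((fun t => f t +i* g t : R[i]^o) @ F) --> (u +i* v : R[i]^o).
Proof.
move=> FF fu gv; apply/cvgrPdist_lt => -[e e'].
rewrite ltcE /= => /andP[/eqP -> e0].
have e2 : 0 < e / 2 by rewrite divr_gt0.
near=> t.
have -> : (u +i* v - (f t +i* g t) : R[i]^o) = (u - f t) +i* (v - g t) by [].
rewrite [X in `|X|]complexE; apply: le_lt_trans (ler_normD _ _) _.
have nC x : `|x%:C : R[i]| = `|x|%:C.
  by rewrite normc_def /= expr0n /= addr0 sqrtr_sqr.
have ni : `|'i%C : R[i]| = 1.
  by rewrite normc_def /= expr0n /= add0r expr1n sqrtr1.
rewrite normrM ni mul1r /= !nC -rmorphD ltcR [e]splitr.
by apply: ltrD; near: t; [move/cvgrPdist_lt: fu|move/cvgrPdist_lt: gv]; exact.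
Unshelve. all: by end_near. Qed.

(** * A path of tuples with distinct entries ending at a given tuple *)

Section Path.
Variables (n : nat) (a : 'rV[R]_n) (sg : R).
Hypothesis sg2 : sg ^+ 2 = 1.

(** Distinct multiples of [e] separate equal entries; the common sign [sg] keeps the path in the
    closed orthant of that sign if it starts there. *)
Definition shift_path (e : R) : 'rV[R]_n := \row_i (a 0 i + e * (sg * i.+1%:R)).

Lemma cvg_shift_path : shift_path e @[e --> 0^'+] --> a.
Proof.
have -> : shift_path = fun e => a + e *: \row_i (sg * i.+1%:R).
  by apply/funext => e; apply/rowP => i; rewrite !mxE.
apply: cvg_at_right_filter.
rewrite -[X in _ --> X](addr0 a) -(scale0r (\row_(i < n) (sg * i.+1%:R))).
by apply: cvgD; [exact: cvg_cst|exact: scalel_continuous].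
Qed.

Lemma shift_path_inj : \forall e \near 0^'+, injective (shift_path e 0).
Proof.
suff H : \forall e \near (0 : R)^'+, forall i : 'I_n, forall j : 'I_n, i != j ->
    a 0 i - a 0 j + e * (sg * (i.+1%:R - j.+1%:R)) != 0.
  apply: filterS H => e H i j; rewrite !mxE => eij.
  apply/eqP; apply: contraT => /(H i j)/eqP; case; move: eij; lra.
apply: filter_forall => i; apply: filter_forall => j.
have [->|ij] := eqVneq i j; first exact: nearW.
have [aij|aij] := eqVneq (a 0 i) (a 0 j).
  have sg0 : sg != 0 by apply: contra_eq_neq sg2 => ->; rewrite expr0n eq_sym oner_eq0.
  have ij' : i.+1%:R - j.+1%:R != 0 :> R by rewrite subr_eq0 eqr_nat eqSS.
  near=> e => _; rewrite aij subrr add0r !mulf_neq0 // gt_eqF //.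
have H : (fun e : R => a 0 i - a 0 j + e * (sg * (i.+1%:R - j.+1%:R))) @ (0 : R)^'+ -->
    a 0 i - a 0 j + 0 * (sg * (i.+1%:R - j.+1%:R)).
  apply: cvg_at_right_filter; apply: cvgD; first exact: cvg_cst.
  by apply: cvgM; [exact: cvg_id|exact: cvg_cst].
have := cvgr_neq0 _ H; rewrite mul0r addr0 subr_eq0 => /(_ _ aij).
by apply: filterS => e + _.
Unshelve. all: by end_near. Qed.

Lemma cvg_shift_path_inj : shift_path @ 0^'+ --> inj_nbhs a.
Proof.
move=> P; rewrite /inj_nbhs /within /= => /cvg_shift_path H.
have {}H : \forall e \near 0^'+, injectiveb (shift_path e 0) -> P (shift_path e) := H.
suff : \forall e \near 0^'+, P (shift_path e) by [].
near=> e.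
have inj : injective (shift_path e 0) by near: e; exact: shift_path_inj.
by have /injectiveP := inj; near: e.
Unshelve. all: by end_near. Qed.

Lemma shift_path_sign e i : 0 <= e -> 0 <= sg * a 0 i -> 0 <= sg * shift_path e 0 i.
Proof.
move=> e0 ai; rewrite mxE mulrDr addr_ge0 // mulrCA [sg * (sg * _)]mulrA -expr2 sg2.
by rewrite mul1r mulr_ge0.
Qed.

End Path.

(** Needed for uniqueness of the limit in [hfrac]; the shifted path eventually enters every set of
    the filter. *)
Global Instance inj_nbhs_proper n (a : 'rV[R]_n) : ProperFilter (inj_nbhs a).
Proof.
split; last exact: inj_nbhs_filter.
move=> /(cvg_shift_path_inj (expr1n _ 2)) H.
exact: (@filter_not_empty _ (0^'+ : set_system R) _ H).
Qed.

(** Puts both branches of [hfrac] in one form, a limit along a path; the constant path serves when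
    the entries are already distinct. *)
Lemma hfrac_path n mu (a : 'rV[R]_n) (sg : R) : (0 < n)%N -> -1 < mu -> a != 0 ->
  sg ^+ 2 = 1 -> let w := mu + n%:R - 1 in
  exists p : R -> 'rV[R]_n, [/\ \forall e \near 0^'+, injective (p e 0),
    \forall e \near 0^'+, forall i, 0 <= sg * a 0 i -> 0 <= sg * p e 0 i,
    p @ 0^'+ --> a &
    divdiff_spow 1 (cos (w * pi)) w [set: 'I_n]%SET (p e) @[e --> 0^'+] -->
      complex.Re (hfrac mu%:C a)].
Proof.
move=> n0 mu1 a0 sg2 w; rewrite /hfrac; case: injectiveP => a_inj.
  exists (fun=> a); split.
  - exact: nearW.
  - exact: nearW.
  - exact: cvg_cst.
  - by rewrite hdistinctE //=; exact: cvg_cst.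
exists (shift_path a sg); split.
- exact: shift_path_inj.
- by near=> e => i; apply: shift_path_sign => //; near: e; exact: nbhs_right_ge.
- exact: cvg_shift_path.
have cw al be : cvg (divdiff_spow al be w [set: 'I_n]%SET @ inj_nbhs a).
  apply: divdiff_spow_cvg.
  - by rewrite -card_gt0 cardsT card_ord.
  (* The condition w > n - 2 is exactly mu > -1. *)
  - rewrite cardsT card_ord /w; lra.
  - left; have [i ai] := rV_neq0_ex a0.
    by exists i; rewrite ?finset.inE.
have /cvg_ex[/= u Hu] := cw 1 (cos (w * pi)).
have /cvg_ex[/= v Hv] := cw 0 (sin (w * pi)).
have H : ((hdistinct mu%:C b : R[i]^o)
            @[b --> within [set b : 'rV[R]_n | injectiveb (b 0)] (nbhs a)])
         --> (u +i* v : R[i]^o).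
  apply: cvg_trans (cvg_complex _ Hu Hv).
  apply: (near_eq_cvg (FF := inj_nbhs_filter a)).
  near=> b; rewrite hdistinctE //; near: b; exact: near_inj_nbhs.
rewrite (cvg_lim (@norm_hausdorff _ _) H) /=.
exact: cvg_comp (cvg_shift_path_inj sg2) Hu.
Unshelve. all: by end_near. Qed.

End Hfrac.

(** * Signs of the cosine and bounds along the path *)

Section Signs.
Variable R : realType.
Implicit Types (mu w be x : R).

Lemma cosDnpi x m : cos (x + m%:R * pi) = (-1) ^+ m * cos x.
Proof.
elim: m => [|m IH]; first by rewrite mul0r addr0 mul1r.
by rewrite -natr1 mulrDl mul1r addrA cosDpi IH exprS mulN1r mulNr.
Qed.

Lemma cos_pi_gt0 x : `|x| < 1 / 2 -> 0 < cos (x * pi).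
Proof.
rewrite ltr_norml => /andP[x1 x2]; have pi0 := pi_gt0 R.
by apply: cos_gt0_pihalf; apply/andP; split; nra.
Qed.

Lemma cos_pi_eq0 x : `|x| = 1 / 2 -> cos (x * pi) = 0.
Proof.
move=> x2; have -> : cos (x * pi) = cos (`|x| * pi).
  by case: (ger0P x) => // _; rewrite mulNr cosN.
by rewrite x2 mul1r mulrC cos_pihalf.
Qed.

Lemma divdiff_spow_nonneg n be be' w (A : {set 'I_n}) (b : 'rV[R]_n) :
  (forall i, 0 <= b 0 i) -> divdiff_spow 1 be w A b = divdiff_spow 1 be' w A b.
Proof.
by move=> b0; apply: eq_divdiff => i _; rewrite /spow [b 0 i < 0]ltNge b0.
Qed.

(** Only the left coefficient acts, so it factors out. It is used with [sg] = (-1)^m, which makes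
    the m-th derivative of the remaining function nonnegative. *)
Lemma divdiff_spow_nonpos n be sg w (A : {set 'I_n}) (b : 'rV[R]_n) :
  sg ^+ 2 = 1 -> (forall i, b 0 i <= 0) ->
  divdiff_spow 1 be w A b = sg * be * divdiff_spow 1 sg w A b.
Proof.
move=> sg2 b0; rewrite /divdiff_spow -divdiffZ; apply: eq_divdiff => i _.
rewrite /spow [0 < b 0 i]ltNge b0 /=; case: ifP => _; last by rewrite mulr0.
by rewrite mulrA [sg * be]mulrC -[be * sg * sg]mulrA -expr2 sg2 mulr1.
Qed.

(** One positive bound [d] serves the whole end of the path, so strict positivity passes to the
    limit. *)
Lemma divdiff_spow_near_lower_bound n be w m (a : 'rV[R]_n) (p : R -> 'rV[R]_n) :
  n = m.+1 -> -1 < w - m%:R -> 0 < (-1) ^+ m * be -> a != 0 ->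
  p @ 0^'+ --> a -> (\forall e \near 0^'+, injective (p e 0)) ->
  exists2 d, 0 < d & \forall e \near 0^'+, d <= divdiff_spow 1 be w [set: 'I_n]%SET (p e).
Proof.
move=> nm wm be0 a0 pa p_inj.
have cT : #|[set: 'I_n]%SET| = m.+1 by rewrite cardsT card_ord.
have [i0 ai0] := rV_neq0_ex a0.
have pc i : p e 0 i @[e --> 0^'+] --> a 0 i.
  exact: (cvg_comp _ _ pa (@coord_continuous R 1 n 0 i a)).
(* Both constants leave strict room at [a], so the bounds persist nearby. *)
pose M := \sum_i `|a 0 i| + 1; pose s := a 0 i0 ^+ 2 / 2.
have sq0 : 0 < a 0 i0 ^+ 2 by rewrite lt_def sqrf_eq0 ai0 sqr_ge0.
have M0 : 0 < M by rewrite ltr_wpDl // sumr_ge0.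
have s0 : 0 < s by rewrite divr_gt0.
have [d d0 Hd] := divdiff_spow_lower_bound cT wm be0 M0 s0.
exists d => //.
have nM : \forall e \near 0^'+, forall i, `|p e 0 i| <= M.
  apply: filter_forall => i; apply: cvgr_norm_le (pc i) _ _.
  by rewrite /M (bigD1 i) //= -addrA ltrDl ltr_wpDl // sumr_ge0.
have ns : \forall e \near 0^'+, s <= p e 0 i0 ^+ 2.
  apply: cvgr_ge (cvgM (pc i0) (pc i0)) _ _.
  by rewrite /s -expr2 ltr_pdivrMr // mulr_natr mulr2n ltrDl.
near=> e; apply: Hd.
- by near: e.
- by move=> i _; move: i; near: e.
- apply: (@le_trans _ _ (p e 0 i0 ^+ 2)); first by near: e.
  by rewrite (bigD1 i0) ?finset.inE //= lerDl sumr_ge0 // => i _; rewrite sqr_ge0.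
Unshelve. all: by end_near. Qed.

End Signs.

Theorem theorem2 (R : realType) (n : nat) (hn : (1 <= n)%N)
    (mu : R) (hmu : -1 < mu) (a : 'rV[R]_n) (ha : a != 0) :
  [/\ (forall p : nat, `|mu - 2 * p%:R| < 1 / 2 ->
         0 < complex.Re (hfrac mu%:C a)),
      (forall p : nat, `|mu - (2 * p%:R - 1)| < 1 / 2 ->
         ((forall i, 0 <= a 0 i) -> 0 < complex.Re (hfrac mu%:C a)) /\
         ((forall i, a 0 i <= 0) -> complex.Re (hfrac mu%:C a) < 0)) &
      (forall p : nat, `|mu - p%:R| = 1 / 2 ->
         0 <= complex.Re (hfrac mu%:C a) /\
         ((forall i, a 0 i <= 0) -> complex.Re (hfrac mu%:C a) = 0))].
Proof.
pose m := n.-1; have nm : n = m.+1 by rewrite prednK.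
pose w := mu + n%:R - 1.
have wE : w = mu + m%:R by rewrite /w nm -natr1 addrA addrK.
have wm : -1 < w - m%:R by rewrite wE addrK.
have cosw : cos (w * pi) = (-1) ^+ m * cos (mu * pi).
  by rewrite wE mulrDl cosDnpi.
have sgm : ((-1) ^+ m) ^+ 2 = 1 :> R by rewrite sqrr_sign.
(* The sign from m differentiations cancels the shift of the cosine by m pi: the left coefficient of
   the m-th derivative has the sign of cos (pi mu). *)
have sgcos : (-1) ^+ m * cos (w * pi) = cos (mu * pi).
  by rewrite cosw mulrA -expr2 sgm mul1r.
have cT : #|[set: 'I_n]%SET| = m.+1 by rewrite cardsT card_ord.
(* On the nonpositive orthant cos (pi mu) factors out, leaving a divided difference that does not
   involve the cosine. *)
have nonpos : (forall i, a 0 i <= 0) ->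
    exists2 p : R -> 'rV[R]_n,
      p @ 0^'+ --> a /\ (\forall e \near 0^'+, injective (p e 0)) &
    cos (mu * pi) * divdiff_spow 1 ((-1) ^+ m) w [set: 'I_n]%SET (p e) @[e --> 0^'+] -->
      complex.Re (hfrac mu%:C a).
  move=> a0; have [|p [p_inj psg pa ph]] := @hfrac_path R n mu a (-1) hn hmu ha.
    by rewrite sqrrN expr1n.
  exists p => //; apply: cvg_trans ph; apply: near_eq_cvg; near=> e.
  rewrite (divdiff_spow_nonpos _ _ _ sgm) ?sgcos // => i; rewrite -oppr_ge0 -mulN1r.
  by have : 0 <= -1 * a 0 i; [rewrite mulN1r oppr_ge0|move: i; near: e].
split.
- move=> q muq.
  have c0 : 0 < cos (mu * pi).
    have -> : mu * pi = (mu - 2 * q%:R) * pi + (2 * q)%:R * pi by rewrite natrM; ring.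
    by rewrite cosDnpi exprM sqrrN !expr1n mul1r cos_pi_gt0.
  have [|p [p_inj _ pa ph]] := @hfrac_path R n mu a 1 hn hmu ha; first exact: expr1n.
  have be0 : 0 < (-1) ^+ m * cos (w * pi) by rewrite sgcos.
  have [d d0 Hd] := divdiff_spow_near_lower_bound nm wm be0 ha pa p_inj.
  exact: lt_le_trans d0 (cvgr_to_ge ph Hd).
- move=> q muq.
  have c0 : cos (mu * pi) < 0.
    have -> : mu * pi = (mu - (2 * q%:R - 1)) * pi + (2 * q)%:R * pi - pi.
      by rewrite natrM; ring.
    rewrite -[X in X < _]opprK -cosDpi subrK cosDnpi exprM sqrrN !expr1n mul1r.
    by rewrite oppr_lt0 cos_pi_gt0.
  have be0 : 0 < (-1) ^+ m * (-1) ^+ m :> R by rewrite -expr2 sgm.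
  split=> a0.
    have [|p [p_inj psg pa ph]] := @hfrac_path R n mu a 1 hn hmu ha; first exact: expr1n.
    have [d d0 Hd] := divdiff_spow_near_lower_bound nm wm be0 ha pa p_inj.
    apply: lt_le_trans d0 (cvgr_to_ge ph _); near=> e.
    (* On nonnegative nodes the left coefficient is never read; it is exchanged for one that makes
       the lower bound applicable. *)
    rewrite (divdiff_spow_nonneg _ ((-1) ^+ m)); first by near: e.
    move=> i; rewrite -[p e 0 i]mul1r.
    by have : 0 <= 1 * a 0 i; [rewrite mul1r|move: i; near: e].
  have [p [pa p_inj] ph] := nonpos a0.
  have [d d0 Hd] := divdiff_spow_near_lower_bound nm wm be0 ha pa p_inj.
  (* The negative cosine turns the lower bound [d] into a negative upper bound that survives the
     limit. *)
  apply: (@le_lt_trans _ _ (cos (mu * pi) * d)); last by rewrite nmulr_rlt0.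
  apply: (cvgr_to_le ph); near=> e; rewrite ler_nM2l //; near: e; exact: Hd.
- move=> q muq.
  (* The m-th derivative now vanishes on the left half-line, which leaves only a weak inequality in
     general. *)
  have c0 : cos (mu * pi) = 0.
    have -> : mu * pi = (mu - q%:R) * pi + q%:R * pi by ring.
    by rewrite cosDnpi cos_pi_eq0 // mulr0.
  split=> [|a0].
    have [|p [p_inj _ pa ph]] := @hfrac_path R n mu a 1 hn hmu ha; first exact: expr1n.
    apply: (cvgr_to_ge ph); near=> e.
    by apply: (divdiff_spow_ge0 _ cT wm); rewrite ?sgcos ?c0 //; near: e.
  have [p _ ph] := nonpos a0; move: ph; rewrite c0.
  under eq_fun do rewrite mul0r.
  by move=> /cvg_lim <- //; rewrite lim_cst.
Unshelve. all: by end_near. Qed.
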